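(* Let $T$ be any recursively enumerable extension of $\mathsf{PA}_\Box$. Then for any $\Sigma_1(\Box)$ sentence $\varphi$, if $\mathbb{N}\models\rho_T(\varphi)$, then $T\vdash\varphi$.
   Context: $\mathcal{L}_A(\Box)$ is the language of arithmetic $\mathcal{L}_A=\{0,S,+,\times,\le,=\}$ plus a unary modal operator $\Box$; derivations use modus ponens, generalization and necessitation (from $\varphi$ infer $\Box\varphi$). $\mathsf{PA}_\Box$ is Peano arithmetic plus first-order logical axioms for $\mathcal{L}_A(\Box)$-formulas (including universal instantiation for $\mathcal{L}_A$-terms) and induction for all $\mathcal{L}_A(\Box)$-formulas. $\Sigma_1(\Box)$ is the smallest class containing arithmetic $\Sigma_1$ formulas and all $\Box\varphi$, closed under $\land,\lor,\exists x,\forall x<t$ ($t$ an $\mathcal{L}_A$-term not containing $x$). For r.e. $T$, $\mathrm{Pr}_T(x)$ is a fixed natural $\Sigma_1$ provability predicate of $T$, and $\ulcorner\psi(\vec{\dot x})\urcorner$ is a primitive recursive term computing the Gödel number of $\psi(\vec{\overline n})$ from $\vec n$. The translation $\rho_T$ to $\mathcal{L}_A$-formulas is the identity on $\mathcal{L}_A$-formulas, commutes with connectives and quantifiers, and sets $\rho_T(\Box\psi(\vec x)):=\mathrm{Pr}_T(\ulcorner\Box\psi(\vec{\dot x})\urcorner)$. $\mathbb{N}$ is the standard model. *)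

(* Defs.v *)
From mathcomp Require Import all_boot.

Set Implicit Arguments.
Unset Strict Implicit.
Unset Printing Implicit Defensive.

(** * The language L_A(Box) *)

(* Variables are de Bruijn indices: under a quantifier, index 0 is the bound
   variable and index i.+1 is the variable i of the surrounding context. *)

Inductive tm : Type :=
| tVar of nat
| tZero
| tSucc of tm
| tAdd of tm & tm
| tMul of tm & tm.

Inductive fm : Type :=
| fEq of tm & tm
| fLe of tm & tm
| fBot
| fAnd of fm & fm
| fOr of fm & fm
| fImp of fm & fm
| fAll of fm
| fEx of fm
| fBox of fm.

Definition fNot A := fImp A fBot.
Definition fLt s t := fLe (tSucc s) t.

(* L_A-formulas are the L_A(Box)-formulas without fBox. *)
Fixpoint arithmetical (A : fm) : Prop :=
  match A with
  | fEq _ _ | fLe _ _ | fBot => True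
  | fAnd A B | fOr A B | fImp A B => arithmetical A /\ arithmetical B
  | fAll A | fEx A => arithmetical A
  | fBox _ => False
  end.

(** ** Substitution *)

Fixpoint subst_tm (s : nat -> tm) (t : tm) : tm :=
  match t with
  | tVar i => s i
  | tZero => tZero
  | tSucc t => tSucc (subst_tm s t)
  | tAdd t u => tAdd (subst_tm s t) (subst_tm s u)
  | tMul t u => tMul (subst_tm s t) (subst_tm s u)
  end.

Definition shift : nat -> tm := fun i => tVar i.+1.

Definition scons {X : Type} (x : X) (s : nat -> X) : nat -> X :=
  fun i => if i is j.+1 then s j else x.

Definition up (s : nat -> tm) : nat -> tm :=
  scons (tVar 0) (fun i => subst_tm shift (s i)).

(* Simultaneous, capture-avoiding substitution; it also acts inside fBox. *)
Fixpoint subst_fm (s : nat -> tm) (A : fm) : fm :=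
  match A with
  | fEq t u => fEq (subst_tm s t) (subst_tm s u)
  | fLe t u => fLe (subst_tm s t) (subst_tm s u)
  | fBot => fBot
  | fAnd A B => fAnd (subst_fm s A) (subst_fm s B)
  | fOr A B => fOr (subst_fm s A) (subst_fm s B)
  | fImp A B => fImp (subst_fm s A) (subst_fm s B)
  | fAll A => fAll (subst_fm (up s) A)
  | fEx A => fEx (subst_fm (up s) A)
  | fBox A => fBox (subst_fm s A)
  end.

Notation lift_tm := (subst_tm shift).
Notation lift_fm := (subst_fm shift).

(* A(t), where index 0 of A is replaced and the other indices drop by one. *)
Definition inst (A : fm) (t : tm) : fm := subst_fm (scons t tVar) A.

(** ** Free variables *)

(* The least k such that all free variables have index < k. *)
Fixpoint fvb_tm (t : tm) : nat :=
  match t with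
  | tVar i => i.+1
  | tZero => 0
  | tSucc t => fvb_tm t
  | tAdd t u | tMul t u => maxn (fvb_tm t) (fvb_tm u)
  end.

Fixpoint fvb (A : fm) : nat :=
  match A with
  | fEq t u | fLe t u => maxn (fvb_tm t) (fvb_tm u)
  | fBot => 0
  | fAnd A B | fOr A B | fImp A B => maxn (fvb A) (fvb B)
  | fAll A | fEx A => (fvb A).-1
  | fBox A => fvb A
  end.

Definition sentence (A : fm) : Prop := fvb A = 0.

(** ** Bounded quantifiers and Sigma_1 *)

(* The bound t lives outside the quantifier, so it cannot contain the
   quantified variable. *)
Definition fAllLt (t : tm) (A : fm) := fAll (fImp (fLt (tVar 0) (lift_tm t)) A).
Definition fExLt (t : tm) (A : fm) := fEx (fAnd (fLt (tVar 0) (lift_tm t)) A).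
Definition fAllLe (t : tm) (A : fm) := fAll (fImp (fLe (tVar 0) (lift_tm t)) A).
Definition fExLe (t : tm) (A : fm) := fEx (fAnd (fLe (tVar 0) (lift_tm t)) A).

Inductive delta0 : fm -> Prop :=
| delta0_eq s t : delta0 (fEq s t)
| delta0_le s t : delta0 (fLe s t)
| delta0_bot : delta0 fBot
| delta0_and A B : delta0 A -> delta0 B -> delta0 (fAnd A B)
| delta0_or A B : delta0 A -> delta0 B -> delta0 (fOr A B)
| delta0_imp A B : delta0 A -> delta0 B -> delta0 (fImp A B)
| delta0_allLt t A : delta0 A -> delta0 (fAllLt t A)
| delta0_exLt t A : delta0 A -> delta0 (fExLt t A)
| delta0_allLe t A : delta0 A -> delta0 (fAllLe t A)
| delta0_exLe t A : delta0 A -> delta0 (fExLe t A).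

Inductive sigma1 : fm -> Prop :=
| sigma1_delta0 A : delta0 A -> sigma1 A
| sigma1_ex A : sigma1 A -> sigma1 (fEx A).

Inductive sigma1box : fm -> Prop :=
| sigma1box_sigma1 A : sigma1 A -> sigma1box A
| sigma1box_box A : sigma1box (fBox A)
| sigma1box_and A B : sigma1box A -> sigma1box B -> sigma1box (fAnd A B)
| sigma1box_or A B : sigma1box A -> sigma1box B -> sigma1box (fOr A B)
| sigma1box_ex A : sigma1box A -> sigma1box (fEx A)
| sigma1box_allLt t A : sigma1box A -> sigma1box (fAllLt t A).

(** * The theory PA_Box and derivability *)

Inductive logical_axiom : fm -> Prop :=
| ax_K A B : logical_axiom (fImp A (fImp B A))
| ax_S A B C : logical_axiom
    (fImp (fImp A (fImp B C)) (fImp (fImp A B) (fImp A C)))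
| ax_botE A : logical_axiom (fImp fBot A)
| ax_dne A : logical_axiom (fImp (fNot (fNot A)) A)
| ax_andI A B : logical_axiom (fImp A (fImp B (fAnd A B)))
| ax_andEl A B : logical_axiom (fImp (fAnd A B) A)
| ax_andEr A B : logical_axiom (fImp (fAnd A B) B)
| ax_orIl A B : logical_axiom (fImp A (fOr A B))
| ax_orIr A B : logical_axiom (fImp B (fOr A B))
| ax_orE A B C : logical_axiom
    (fImp (fImp A C) (fImp (fImp B C) (fImp (fOr A B) C)))
| ax_allE A t : logical_axiom (fImp (fAll A) (inst A t))
| ax_allI A B : logical_axiom
    (fImp (fAll (fImp (lift_fm A) B)) (fImp A (fAll B)))
| ax_exI A t : logical_axiom (fImp (inst A t) (fEx A))
| ax_exE A B : logical_axiom
    (fImp (fAll (fImp A (lift_fm B))) (fImp (fEx A) B))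
| ax_eq_refl t : logical_axiom (fEq t t)
| ax_eq_subst A s t : logical_axiom (fImp (fEq s t) (fImp (inst A s) (inst A t))).

(* Axioms with free variables stand for their universal closures, since
   derivations may use generalization. *)
Inductive PA_axiom : fm -> Prop :=
| PA_succ_neq0 : PA_axiom (fNot (fEq (tSucc (tVar 0)) tZero))
| PA_succ_inj : PA_axiom
    (fImp (fEq (tSucc (tVar 0)) (tSucc (tVar 1))) (fEq (tVar 0) (tVar 1)))
| PA_add0 : PA_axiom (fEq (tAdd (tVar 0) tZero) (tVar 0))
| PA_addS : PA_axiom
    (fEq (tAdd (tVar 0) (tSucc (tVar 1))) (tSucc (tAdd (tVar 0) (tVar 1))))
| PA_mul0 : PA_axiom (fEq (tMul (tVar 0) tZero) tZero)
| PA_mulS : PA_axiom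
    (fEq (tMul (tVar 0) (tSucc (tVar 1))) (tAdd (tMul (tVar 0) (tVar 1)) (tVar 0)))
| PA_le1 : PA_axiom
    (fImp (fLe (tVar 0) (tVar 1)) (fEx (fEq (tAdd (tVar 0) (tVar 1)) (tVar 2))))
| PA_le2 : PA_axiom
    (fImp (fEx (fEq (tAdd (tVar 0) (tVar 1)) (tVar 2))) (fLe (tVar 0) (tVar 1)))
| PA_ind A : PA_axiom   (* for every L_A(Box)-formula A *)
    (fImp (inst A tZero)
      (fImp (fAll (fImp A (subst_fm (scons (tSucc (tVar 0)) shift) A)))
        (fAll A))).

Definition PAbox (A : fm) : Prop := logical_axiom A \/ PA_axiom A.

Inductive derives (T : fm -> Prop) : fm -> Prop :=
| derives_axiom A : T A -> derives T A
| derives_mp A B : derives T (fImp A B) -> derives T A -> derives T B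
| derives_gen A : derives T A -> derives T (fAll A)
| derives_nec A : derives T A -> derives T (fBox A).

Definition extends_PAbox (T : fm -> Prop) : Prop :=
  forall A, derives PAbox A -> derives T A.

(** * The standard model *)

Fixpoint eval (e : nat -> nat) (t : tm) : nat :=
  match t with
  | tVar i => e i
  | tZero => 0
  | tSucc t => (eval e t).+1
  | tAdd t u => eval e t + eval e u
  | tMul t u => eval e t * eval e u
  end.

(* N only interprets L_A-formulas; the value at fBox is a dummy.  The
   translation rho only produces L_A-formulas (rho_arithmetical). *)
Fixpoint sat (e : nat -> nat) (A : fm) : Prop :=
  match A with
  | fEq t u => eval e t = eval e u
  | fLe t u => eval e t <= eval e u
  | fBot => False
  | fAnd A B => sat e A /\ sat e B
  | fOr A B => sat e A \/ sat e B
  | fImp A B => sat e A -> sat e B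
  | fAll A => forall n, sat (scons n e) A
  | fEx A => exists n, sat (scons n e) A
  | fBox _ => False
  end.

Definition true_in_N (A : fm) : Prop := forall e, sat e A.

(** * Goedel numbering *)

Definition num (n : nat) : tm := iter n tSucc tZero.

(* An injective pairing which is an L_A-term. *)
Definition npair (a b : nat) : nat := (a + b) * (a + b) + a.
Definition tpair (a b : tm) : tm := tAdd (tMul (tAdd a b) (tAdd a b)) a.

(* The Goedel number is computed in X with numbers k and pairing p; v d i is
   the value for the variable of index i met below d quantifiers. *)
Section CodeWith.
Variables (X : Type) (k : nat -> X) (p : X -> X -> X) (v : nat -> nat -> X).

Fixpoint code_tm_with (d : nat) (t : tm) : X :=
  match t with
  | tVar i => v d i
  | tZero => p (k 0) (k 0)
  | tSucc t => p (k 2) (code_tm_with d t)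
  | tAdd t u => p (k 3) (p (code_tm_with d t) (code_tm_with d u))
  | tMul t u => p (k 4) (p (code_tm_with d t) (code_tm_with d u))
  end.

Fixpoint code_fm_with (d : nat) (A : fm) : X :=
  match A with
  | fEq t u => p (k 0) (p (code_tm_with d t) (code_tm_with d u))
  | fLe t u => p (k 1) (p (code_tm_with d t) (code_tm_with d u))
  | fBot => p (k 2) (k 0)
  | fAnd A B => p (k 3) (p (code_fm_with d A) (code_fm_with d B))
  | fOr A B => p (k 4) (p (code_fm_with d A) (code_fm_with d B))
  | fImp A B => p (k 5) (p (code_fm_with d A) (code_fm_with d B))
  | fAll A => p (k 6) (code_fm_with d.+1 A)
  | fEx A => p (k 7) (code_fm_with d.+1 A)
  | fBox A => p (k 8) (code_fm_with d A)
  end.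

End CodeWith.

Definition code_tm (t : tm) : nat := code_tm_with id npair (fun _ i => npair 1 i) 0 t.
Definition code (A : fm) : nat := code_fm_with id npair (fun _ i => npair 1 i) 0 A.

(* If index i has the value code_tm (num n_i), this L_A-term has the value
   code A(num n_0, num n_1, ...): bound variables get their constant code,
   free variables become free variables of the term. *)
Definition dotted_code (A : fm) : tm :=
  code_fm_with num tpair
    (fun d i => if i < d then tpair (num 1) (num i) else tVar (i - d)) 0 A.

(* Goedel's beta function: r is the remainder of a modulo 1 + (i + 1) b. *)
Definition fBeta (a b i r : tm) : fm :=
  let m := tSucc (tMul (tSucc i) b) in
  fAnd (fLt r m)
    (fExLe a (fEq (lift_tm a) (tAdd (tMul (tVar 0) (lift_tm m)) (lift_tm r)))).

(* "variable 1 is the Goedel number of the numeral of variable 0": some sequence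
   coded by beta starts with the code of 0, applies t |-> S t at each step, and
   reaches variable 1 at the place given by variable 0. *)
Definition fNumGraph : fm :=
  fEx (fEx
    (let b := tVar 0 in let a := tVar 1 in let x := tVar 2 in let y := tVar 3 in
     fAnd (fBeta a b tZero (num (code_tm tZero)))
    (fAnd (fBeta a b x y)
    (fAllLt x
      (let i := tVar 0 in let b := tVar 1 in let a := tVar 2 in
       fExLe a
         (let u := tVar 0 in let i := tVar 1 in let b := tVar 2 in let a := tVar 3 in
          fAnd (fBeta a b i u) (fBeta a b (tSucc i) (tpair (num 2) u)))))))).

(** * Recursively enumerable theories *)

Inductive partial_recursive : forall n, (n.-tuple nat -> nat -> Prop) -> Prop :=
| pr_zero : @partial_recursive 0 (fun _ y => y = 0)
| pr_succ : @partial_recursive 1 (fun v y => y = (tnth v ord0).+1)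
| pr_proj n (i : 'I_n) : @partial_recursive n (fun v y => y = tnth v i)
| pr_comp m n (g : m.-tuple nat -> nat -> Prop)
    (h : 'I_m -> n.-tuple nat -> nat -> Prop) :
    partial_recursive g -> (forall i, partial_recursive (h i)) ->
    @partial_recursive n (fun v y =>
      exists w : m.-tuple nat, (forall i, h i v (tnth w i)) /\ g w y)
| pr_rec n (f : n.-tuple nat -> nat -> Prop) (g : n.+2.-tuple nat -> nat -> Prop) :
    partial_recursive f -> partial_recursive g ->
    @partial_recursive n.+1 (fun v y =>
      exists w : nat -> nat,
        [/\ f [tuple of behead v] (w 0),
            forall i, i < thead v -> g [tuple of i :: w i :: behead v] (w i.+1)
          & y = w (thead v)])
| pr_mu n (f : n.+1.-tuple nat -> nat -> Prop) :
    partial_recursive f ->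
    @partial_recursive n (fun v y =>
      f [tuple of y :: v] 0 /\
      forall z, z < y -> exists k, f [tuple of z :: v] k.+1).

Definition recursively_enumerable (P : nat -> Prop) : Prop :=
  exists2 f : 1.-tuple nat -> nat -> Prop,
    partial_recursive f & forall n, P n <-> exists y, f [tuple n] y.

Definition re_theory (T : fm -> Prop) : Prop :=
  recursively_enumerable (fun n => exists2 A, T A & code A = n).

(** * Provability predicates and the translation rho *)

(* Sigma_1 formulas defining, in N, the set of Goedel numbers of the theorems
   of T. *)
Definition provability_predicate (T : fm -> Prop) (Pr : fm) : Prop :=
  [/\ sigma1 Pr, fvb Pr <= 1
    & forall n, true_in_N (inst Pr (num n)) <-> exists2 A, derives T A & code A = n].

(* With k an upper bound on the free variables x_i of A, the formula
     exists m_(k-1) ... m_0, (/\_(i < k) m_i is the code of the numeral of x_i)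
                             /\ Pr(dotted_code A (m_0, ..., m_(k-1)))
   expresses Pr of the Goedel number of A with the numerals of its free
   variables substituted.  Below the k quantifiers, m_i is index i and x_i is
   index k + i. *)
Definition fPr_dotted (Pr A : fm) : fm :=
  let k := fvb A in
  iter k fEx
    (foldr (fun i => fAnd (subst_fm (scons (tVar (k + i)) (scons (tVar i) tVar)) fNumGraph))
       (inst Pr (dotted_code A)) (iota 0 k)).

Fixpoint rho (Pr A : fm) : fm :=
  match A with
  | fEq _ _ | fLe _ _ | fBot => A
  | fAnd A B => fAnd (rho Pr A) (rho Pr B)
  | fOr A B => fOr (rho Pr A) (rho Pr B)
  | fImp A B => fImp (rho Pr A) (rho Pr B)
  | fAll A => fAll (rho Pr A)
  | fEx A => fEx (rho Pr A)
  | fBox A => fPr_dotted Pr (fBox A)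
  end.

Lemma subst_arithmetical s A : arithmetical A -> arithmetical (subst_fm s A).
Proof.
elim: A s => //= [A IA B IB|A IA B IB|A IA B IB|A IA|A IA] s.
1-3: by case=> /IA ? /IB.
all: by move/IA.
Qed.

Lemma sigma1_arithmetical A : sigma1 A -> arithmetical A.
Proof. by elim=> // {}A; elim. Qed.

Lemma rho_arithmetical Pr A : arithmetical Pr -> arithmetical (rho Pr A).
Proof.
move=> hP; elim: A => //= A _; rewrite /fPr_dotted; set k := fvb _.
have: arithmetical (foldr (fun i => fAnd
    (subst_fm (scons (tVar (k + i)) (scons (tVar i) tVar)) fNumGraph))
    (inst Pr (dotted_code (fBox A))) (iota 0 k)).
  by elim: iota => [|i s IH] //=; exact: subst_arithmetical.
by move: (foldr _ _ _) => F; elim: k.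
Qed.

Lemma rho_id Pr A : arithmetical A -> rho Pr A = A.
Proof.
elim: A => //= [A IA B IB|A IA B IB|A IA B IB|A IA|A IA].
1-3: by case=> /IA -> /IB ->.
all: by move/IA ->.
Qed.

(* Main.v *)
(* By induction on Sigma_1(Box) formulas with the free variables replaced by
   numerals, every formula whose translation is true is derivable.  Arithmetical
   Sigma_1 formulas are handled by Sigma_1-completeness; a bounded universal
   quantifier is handled by the bounded-quantification principle "if A(0), ...,
   A(k-1) are derivable, so is x < k -> A(x)", which uses induction only as
   a case distinction zero/successor.  For Box A, the translation is true exactly
   when T proves Box A itself, because codes are injective. *)

From Stdlib Require Import Setoid.
Require Import Defs.
From mathcomp Require Import all_boot.

Set Implicit Arguments.
Unset Strict Implicit.
Unset Printing Implicit Defensive.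

(** * Substitution and evaluation *)

Lemma subst_tm_ext s s' t :
  (forall i, i < fvb_tm t -> s i = s' i) -> subst_tm s t = subst_tm s' t.
Proof.
elim: t => //= [i|t IH|t IHt u IHu|t IHt u IHu] E; first exact: E.
- by rewrite IH.
all: by rewrite IHt ?IHu // => i Hi; apply: E; rewrite leq_max Hi ?orbT.
Qed.

Lemma up_ext s s' n : (forall i, i < n.-1 -> s i = s' i) ->
  forall i, i < n -> up s i = up s' i.
Proof. by case: n => [|n] E [|i] //= Hi; rewrite /up /= E. Qed.

Lemma subst_fm_ext_fvb s s' A :
  (forall i, i < fvb A -> s i = s' i) -> subst_fm s A = subst_fm s' A.
Proof.
elim: A s s' => //= [t u|t u|A IA B IB|A IA B IB|A IA B IB|A IA|A IA|A IA] s s' E.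
1-2: by rewrite (@subst_tm_ext s s' t) ?(@subst_tm_ext s s' u) // => i Hi;
  apply: E; rewrite leq_max Hi ?orbT.
1-3: by rewrite (IA s s') ?(IB s s') // => i Hi; apply: E; rewrite leq_max Hi ?orbT.
1-2: by rewrite (IA (up s) (up s')) //; apply: up_ext.
by rewrite (IA s s').
Qed.

Lemma subst_fm_ext s s' A : s =1 s' -> subst_fm s A = subst_fm s' A.
Proof. by move=> E; apply: subst_fm_ext_fvb => i _. Qed.

Lemma subst_tm_var t : subst_tm tVar t = t.
Proof. by elim: t => //= [t ->|t -> u ->|t -> u ->]. Qed.

Lemma subst_fm_var A : subst_fm tVar A = A.
Proof.
have E B : subst_fm (up tVar) B = subst_fm tVar B.
  by apply: subst_fm_ext => -[|i].
elim: A => //= [t u|t u|A -> B ->|A -> B ->|A -> B ->|A IA|A IA|A ->] //.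
1-2: by rewrite !subst_tm_var.
all: by rewrite E IA.
Qed.

Lemma subst_tm_comp s s' t :
  subst_tm s' (subst_tm s t) = subst_tm (fun i => subst_tm s' (s i)) t.
Proof. by elim: t => //= [t ->|t -> u ->|t -> u ->]. Qed.

Lemma up_comp s s' i :
  subst_tm (up s') (up s i) = up (fun i => subst_tm s' (s i)) i.
Proof. by case: i => [|i] //; rewrite /up /= !subst_tm_comp. Qed.

Lemma subst_fm_comp s s' A :
  subst_fm s' (subst_fm s A) = subst_fm (fun i => subst_tm s' (s i)) A.
Proof.
elim: A s s' => //= [t u|t u|A IA B IB|A IA B IB|A IA B IB|A IA|A IA|A IA] s s'.
1-2: by rewrite !subst_tm_comp.
1-3: by rewrite IA IB.
1-2: by rewrite IA; congr (_ _); apply: subst_fm_ext => i; rewrite up_comp.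
by rewrite IA.
Qed.

Lemma inst_up s A t :
  inst (subst_fm (up s) A) t = subst_fm (scons t s) A.
Proof.
rewrite /inst subst_fm_comp; apply: subst_fm_ext => -[|i] //.
by rewrite /up /= subst_tm_comp subst_tm_var.
Qed.

Lemma inst_up_shift A : inst (subst_fm (up shift) A) (tVar 0) = A.
Proof.
by rewrite inst_up -[RHS]subst_fm_var; apply: subst_fm_ext => -[].
Qed.

Lemma inst_lift_tm s t : subst_tm (scons s tVar) (lift_tm t) = t.
Proof. by rewrite subst_tm_comp subst_tm_var. Qed.

Lemma subst_num s n : subst_tm s (num n) = num n.
Proof. by elim: n => //= n ->. Qed.

(** * Evaluation and satisfaction in the standard model *)

Lemma eval_num e n : eval e (num n) = n.
Proof. by elim: n => //= n ->. Qed.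

Lemma eval_ext e e' t :
  (forall i, i < fvb_tm t -> e i = e' i) -> eval e t = eval e' t.
Proof.
elim: t => //= [i|t IH|t IHt u IHu|t IHt u IHu] E; first exact: E.
- by rewrite IH.
all: by rewrite IHt ?IHu // => i Hi; apply: E; rewrite leq_max Hi ?orbT.
Qed.

Lemma sat_ext e e' A :
  (forall i, i < fvb A -> e i = e' i) -> sat e A <-> sat e' A.
Proof.
have sconsE n k f f' : (forall i, i < k.-1 -> f i = f' i) ->
    forall i, i < k -> scons (n : nat) f i = scons n f' i.
  by case: k => [|k] E [|i] //= Hi; rewrite E.
elim: A e e' => //= [t u|t u|A IA B IB|A IA B IB|A IA B IB|A IA|A IA] e e' E.
1-2: by rewrite (@eval_ext e e' t) ?(@eval_ext e e' u) // => i Hi;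
  apply: E; rewrite leq_max Hi ?orbT.
1-3: by rewrite (IA e e') ?(IB e e') // => i Hi; apply: E; rewrite leq_max Hi ?orbT.
- by split=> H n; have := H n; rewrite (IA _ _ (sconsE n _ _ _ E)).
- by split=> -[n H]; exists n; move: H; rewrite (IA _ _ (sconsE n _ _ _ E)).
Qed.

Lemma sat_eq_env e e' A :
  (forall i, i < fvb A -> e i = e' i) -> sat e A -> sat e' A.
Proof. by move=> /sat_ext E /E. Qed.

Lemma eval_subst e s t : eval e (subst_tm s t) = eval (fun i => eval e (s i)) t.
Proof. by elim: t => //= [t ->|t -> u ->|t -> u ->]. Qed.

Lemma sat_subst e s A :
  sat e (subst_fm s A) <-> sat (fun i => eval e (s i)) A.
Proof.
have upE n f r i : eval (scons n f) (up r i) = scons n (fun i => eval f (r i)) i.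
  by case: i => [|i] //; rewrite /up /= eval_subst.
elim: A e s => //= [t u|t u|A IA B IB|A IA B IB|A IA B IB|A IA|A IA] e s.
1-2: by rewrite !eval_subst.
1-3: by rewrite IA IB.
- by split=> H n; have := H n; rewrite IA (sat_ext (fun i _ => upE n e s i)).
- by split=> -[n H]; exists n; move: H; rewrite IA (sat_ext (fun i _ => upE n e s i)).
Qed.

(** * Derivations *)

Section Derivations.

Variable T : fm -> Prop.
Hypothesis hPA : extends_PAbox T.

Notation "|- A" := (derives T A) (at level 75).

Lemma derives_logic A : logical_axiom A -> |- A.
Proof. by move=> H; apply/hPA/derives_axiom; left. Qed.

Lemma derives_PA A : PA_axiom A -> |- A.
Proof. by move=> H; apply/hPA/derives_axiom; right. Qed.

Lemma weaken A B : |- B -> |- fImp A B.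
Proof. exact/derives_mp/derives_logic/ax_K. Qed.

Lemma imp_app A B C : |- fImp A (fImp B C) -> |- fImp A B -> |- fImp A C.
Proof. by move=> H; apply: derives_mp (derives_mp _ H); apply/derives_logic/ax_S. Qed.

Lemma imp_refl A : |- fImp A A.
Proof. by apply: (@imp_app _ (fImp A A)); apply/derives_logic/ax_K. Qed.

Lemma imp_trans B A C : |- fImp A B -> |- fImp B C -> |- fImp A C.
Proof. by move=> HAB HBC; apply: imp_app HAB; apply: weaken. Qed.

Lemma imp_mp A B C : |- fImp A (fImp B C) -> |- B -> |- fImp A C.
Proof. by move=> H HB; apply: imp_app H _; apply: weaken. Qed.

Lemma and_elim A B C : |- fImp A (fImp B C) -> |- fImp (fAnd A B) C.
Proof.
move=> H; apply: (@imp_app _ B); last exact/derives_logic/ax_andEr.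
by apply: imp_trans H; apply/derives_logic/ax_andEl.
Qed.

Lemma and_intro A B : |- A -> |- B -> |- fAnd A B.
Proof.
by move=> HA; apply/derives_mp; apply: derives_mp HA; apply/derives_logic/ax_andI.
Qed.

Lemma all_elim A t : |- fAll A -> |- inst A t.
Proof. exact/derives_mp/derives_logic/ax_allE. Qed.

Lemma ex_intro A t : |- inst A t -> |- fEx A.
Proof. exact/derives_mp/derives_logic/ax_exI. Qed.

Lemma ex_elim A B : |- fImp A (lift_fm B) -> |- fImp (fEx A) B.
Proof. by move=> H; apply: derives_mp (derives_gen H); apply/derives_logic/ax_exE. Qed.

Lemma ex_mono A B : |- fImp A B -> |- fImp (fEx A) (fEx B).
Proof.
move=> H; apply/ex_elim/(imp_trans H).
(* [B] is read as the instance at variable 0 of its own copy shifted below the quantifier. *)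
by rewrite -{1}[B]inst_up_shift; apply/derives_logic/ax_exI.
Qed.

(** The axioms of [T] need not be closed under substitution, so induction on the derivation would
    fail. Instead all free variables are generalized and the quantifiers instantiated one by one. *)
Lemma derives_subst s A : |- A -> |- subst_fm s A.
Proof.
move=> HA.
have gens n B : |- iter n fAll B ->
    |- subst_fm (fun i => if i < n then s i else tVar (i - n)) B.
  elim: n s B => [|n IH] r B.
    rewrite (@subst_fm_ext _ tVar) ?subst_fm_var // => i.
    by rewrite subn0.
  (* The outer quantifiers take [r 1], [r 2], ... by induction; the innermost one, index 0, takes
     [r 0]. *)
  rewrite iterSr => /(IH (r \o succn)) /= /all_elim -/(_ (r 0)).
  rewrite inst_up (@subst_fm_ext _ (fun i => if i < n.+1 then r i else tVar (i - n.+1))) //.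
  by case=> [|i].
have {}HA : |- iter (fvb A) fAll A by elim: (fvb A) => //= n; apply: derives_gen.
move/gens: HA; rewrite (@subst_fm_ext_fvb _ s) // => i Hi.
by rewrite Hi.
Qed.

(** Instantiation lowers the other indices by one, so they are shifted up beforehand. *)
Lemma all_elim_open A : |- fAll A -> |- A.
Proof.
by move=> /(derives_subst shift) /= /all_elim -/(_ (tVar 0)); rewrite inst_up_shift.
Qed.

(** * Arithmetic in extensions of PA *)

Lemma eq_subst A s t : |- fEq s t -> |- inst A s -> |- inst A t.
Proof.
move=> Hst; apply/derives_mp; apply: derives_mp Hst.
exact/derives_logic/ax_eq_subst.
Qed.

Lemma eq_subst_imp A s t : |- inst A s -> |- fImp (fEq s t) (inst A t).
Proof. by apply: imp_mp; apply/derives_logic/ax_eq_subst. Qed.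

Lemma eq_refl t : |- fEq t t.
Proof. exact/derives_logic/ax_eq_refl. Qed.

Lemma eq_sym_imp s t : |- fImp (fEq s t) (fEq t s).
Proof.
have := @eq_subst_imp (fEq (tVar 0) (lift_tm s)) s t.
by rewrite /inst /= !inst_lift_tm; apply; apply: eq_refl.
Qed.

Lemma eq_sym s t : |- fEq s t -> |- fEq t s.
Proof. exact/derives_mp/eq_sym_imp. Qed.

Lemma eq_trans s t u : |- fEq s t -> |- fEq t u -> |- fEq s u.
Proof.
move=> Hst Htu.
have := @eq_subst (fEq (lift_tm s) (tVar 0)) _ _ Htu.
by rewrite /inst /= !inst_lift_tm; apply.
Qed.

Lemma eq_congr t s s' :
  |- fEq s s' -> |- fEq (subst_tm (scons s tVar) t) (subst_tm (scons s' tVar) t).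
Proof.
move=> H; have := @eq_subst (fEq (lift_tm (subst_tm (scons s tVar) t)) t) _ _ H.
by rewrite /inst /= !inst_lift_tm; apply; apply: eq_refl.
Qed.

Lemma eq_succ s s' : |- fEq s s' -> |- fEq (tSucc s) (tSucc s').
Proof. exact: (@eq_congr (tSucc (tVar 0))). Qed.

Lemma eq_succ_imp s t : |- fImp (fEq s t) (fEq (tSucc s) (tSucc t)).
Proof.
have := @eq_subst_imp (fEq (lift_tm (tSucc s)) (tSucc (tVar 0))) s t.
by rewrite /inst /= !inst_lift_tm; apply; apply: eq_refl.
Qed.

Lemma eq_add s s' t t' :
  |- fEq s s' -> |- fEq t t' -> |- fEq (tAdd s t) (tAdd s' t').
Proof.
move=> /(@eq_congr (tAdd (tVar 0) (lift_tm t))) Hs.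
move=> /(@eq_congr (tAdd (lift_tm s') (tVar 0))) Ht.
by move: Hs Ht; rewrite /= !inst_lift_tm; apply: eq_trans.
Qed.

Lemma eq_mul s s' t t' :
  |- fEq s s' -> |- fEq t t' -> |- fEq (tMul s t) (tMul s' t').
Proof.
move=> /(@eq_congr (tMul (tVar 0) (lift_tm t))) Hs.
move=> /(@eq_congr (tMul (lift_tm s') (tVar 0))) Ht.
by move: Hs Ht; rewrite /= !inst_lift_tm; apply: eq_trans.
Qed.

Lemma eq_congr_eq s s' t t' :
  |- fEq s s' -> |- fEq t t' -> |- fImp (fEq s t) (fEq s' t').
Proof.
(* Starting from [st -> st], the antecedent stays fixed while the two sides of the succedent are
   replaced in turn. *)
move=> Hs Ht; set st := fEq (lift_tm s) (lift_tm t).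
have H1 := @eq_subst (fImp st (fEq (tVar 0) (lift_tm t))) _ _ Hs.
have H2 := @eq_subst (fImp st (fEq (lift_tm s') (tVar 0))) _ _ Ht.
by move: H1 H2; rewrite /inst /= !inst_lift_tm => H1; apply; apply: H1; apply: imp_refl.
Qed.

Lemma eq_congr_le s s' t t' :
  |- fEq s s' -> |- fEq t t' -> |- fImp (fLe s t) (fLe s' t').
Proof.
move=> Hs Ht; set st := fLe (lift_tm s) (lift_tm t).
have H1 := @eq_subst (fImp st (fLe (tVar 0) (lift_tm t))) _ _ Hs.
have H2 := @eq_subst (fImp st (fLe (lift_tm s') (tVar 0))) _ _ Ht.
by move: H1 H2; rewrite /inst /= !inst_lift_tm => H1; apply; apply: H1; apply: imp_refl.
Qed.

(** * Successor, recursion equations and order for arbitrary terms *)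

Lemma succ_neq0 s : |- fNot (fEq (tSucc s) tZero).
Proof. exact: (derives_subst (scons s tVar) (derives_PA PA_succ_neq0)). Qed.

Lemma succ_inj s t : |- fImp (fEq (tSucc s) (tSucc t)) (fEq s t).
Proof. exact: (derives_subst (scons s (scons t tVar)) (derives_PA PA_succ_inj)). Qed.

Lemma add0 s : |- fEq (tAdd s tZero) s.
Proof. exact: (derives_subst (scons s tVar) (derives_PA PA_add0)). Qed.

Lemma addS s t : |- fEq (tAdd s (tSucc t)) (tSucc (tAdd s t)).
Proof. exact: (derives_subst (scons s (scons t tVar)) (derives_PA PA_addS)). Qed.

Lemma mul0 s : |- fEq (tMul s tZero) tZero.
Proof. exact: (derives_subst (scons s tVar) (derives_PA PA_mul0)). Qed.

Lemma mulS s t : |- fEq (tMul s (tSucc t)) (tAdd (tMul s t) s).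
Proof. exact: (derives_subst (scons s (scons t tVar)) (derives_PA PA_mulS)). Qed.

Lemma le_ex s t : |- fImp (fLe s t) (fEx (fEq (tAdd (tVar 0) (lift_tm s)) (lift_tm t))).
Proof. exact: (derives_subst (scons s (scons t tVar)) (derives_PA PA_le1)). Qed.

Lemma ex_le s t : |- fImp (fEx (fEq (tAdd (tVar 0) (lift_tm s)) (lift_tm t))) (fLe s t).
Proof. exact: (derives_subst (scons s (scons t tVar)) (derives_PA PA_le2)). Qed.

(** Order is defined by z + s = t with s as the right summand, so the recursion equation for
    addition pulls the successor out and the same z works. *)
Lemma le_succ_inv s t : |- fImp (fLe (tSucc s) (tSucc t)) (fLe s t).
Proof.
apply: imp_trans (le_ex _ _) _; apply: imp_trans _ (ex_le _ _); apply: ex_mono => /=.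
by apply: imp_trans (succ_inj _ _); apply: eq_congr_eq; [apply: addS|apply: eq_refl].
Qed.

Lemma le_succ s t : |- fImp (fLe s t) (fLe (tSucc s) (tSucc t)).
Proof.
apply: imp_trans (le_ex _ _) _; apply: imp_trans _ (ex_le _ _); apply: ex_mono => /=.
apply: imp_trans (eq_succ_imp _ _) _.
by apply: eq_congr_eq; [apply/eq_sym/addS|apply: eq_refl].
Qed.

Lemma lt0_false s : |- fNot (fLe (tSucc s) tZero).
Proof.
apply: imp_trans (le_ex _ _) _; apply: ex_elim => /=.
by apply: imp_trans (succ_neq0 _); apply: eq_congr_eq; [apply: addS|apply: eq_refl].
Qed.

(** * Provable comparison and computation of numerals *)

Lemma eq_num m n : m <> n -> |- fNot (fEq (num m) (num n)).
Proof.
elim: m n => [|m IH] [|n] //= Hmn.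
- exact: imp_trans (eq_sym_imp _ _) (succ_neq0 _).
- exact: succ_neq0.
- by apply: imp_trans (succ_inj _ _) (IH _ _) => E; case: Hmn; rewrite E.
Qed.

Lemma le_num m n : m <= n -> |- fLe (num m) (num n).
Proof.
elim: m n => [|m IH] n Hmn; last by case: n Hmn => // n /IH; apply/derives_mp/le_succ.
apply: derives_mp (ex_le _ _) _; apply: (@ex_intro _ (num n)).
by rewrite /inst /= !subst_num; apply: add0.
Qed.

Lemma not_le_num m n : n < m -> |- fNot (fLe (num m) (num n)).
Proof.
elim: m n => [|m IH] [|n] //= Hmn; first exact: lt0_false.
exact: imp_trans (le_succ_inv _ _) (IH _ _).
Qed.

Lemma num_add m n : |- fEq (tAdd (num m) (num n)) (num (m + n)).
Proof.
elim: n => [|n IH]; first by rewrite addn0; apply: add0.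
by rewrite addnS; apply: eq_trans (addS _ _) (eq_succ IH).
Qed.

Lemma num_mul m n : |- fEq (tMul (num m) (num n)) (num (m * n)).
Proof.
elim: n => [|n IH]; first by rewrite muln0; apply: mul0.
rewrite mulnSr; apply: eq_trans (mulS _ _) (eq_trans _ (num_add _ _)).
exact: eq_add IH (eq_refl _).
Qed.

Lemma num_eval e t : |- fEq (subst_tm (num \o e) t) (num (eval e t)).
Proof.
elim: t => /= [i||t IH|t IHt u IHu|t IHt u IHu]; try exact: eq_refl.
- exact: eq_succ.
- exact: eq_trans (eq_add IHt IHu) (num_add _ _).
- exact: eq_trans (eq_mul IHt IHu) (num_mul _ _).
Qed.

(* Metatheoretic induction on k, for all A at once: PA_ind applied to
   x < k -> A(x) serves as a case distinction x = 0 or x = S x', and in the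
   second case A(S x') takes the place of A. *)
Lemma lt_num_cases k A : (forall i, i < k -> |- inst A (num i)) ->
  |- fImp (fLt (tVar 0) (num k)) A.
Proof.
elim: k A => [|k IH] A HA.
  exact: imp_trans (lt0_false _) (derives_logic (ax_botE _)).
apply: all_elim_open.
apply: derives_mp (derives_mp (derives_PA (PA_ind _)) _) _.
  by rewrite /inst /= subst_num; apply: weaken; apply: (HA 0).
apply/derives_gen/weaken; rewrite /= subst_num.
apply: imp_trans (le_succ_inv _ _) _; apply: IH => i Hi.
rewrite /inst subst_fm_comp (@subst_fm_ext _ (scons (num i.+1) tVar)); first exact: HA.
by case.
Qed.

(* G(x) behaves, provably, as the finite disjunction of x = 0, ..., x = k-1. *)
Definition guards (G : fm) (k : nat) : Prop :=
  (forall i, i < k -> |- inst G (num i)) /\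
  (forall A, (forall i, i < k -> |- inst A (num i)) -> |- fImp G A).

(** The bound occurs instantiated in one half of [guards] and as it stands in the other; an equation
    valid under every substitution covers both. Closed terms of value k satisfy it. *)
Lemma guards_lt t k : (forall s, |- fEq (subst_tm s t) (num k)) ->
  guards (fLt (tVar 0) t) k.
Proof.
move=> Ht; split=> [i Hi|A HA].
  apply: derives_mp (eq_congr_le (eq_refl _) (eq_sym (Ht _))) _.
  exact: (@le_num i.+1).
have H := Ht tVar; rewrite subst_tm_var in H.
exact: imp_trans (eq_congr_le (eq_refl _) H) (lt_num_cases HA).
Qed.

Lemma guards_le t k : (forall s, |- fEq (subst_tm s t) (num k)) ->
  guards (fLe (tVar 0) t) k.+1.
Proof.
move=> Ht; split=> [i Hi|A HA].
  apply: derives_mp (eq_congr_le (eq_refl _) (eq_sym (Ht _))) _.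
  exact: le_num.
have H := Ht tVar; rewrite subst_tm_var in H.
apply: imp_trans (eq_congr_le (eq_refl _) H) _.
(* x <= k becomes x < k + 1, hence the [k.+1] cases. *)
exact: imp_trans (le_succ _ _) (lt_num_cases HA).
Qed.

Notation closed e A := (subst_fm (num \o e) A).

Lemma up_num_lift e t :
  subst_tm (up (num \o e)) (lift_tm t) = subst_tm (num \o e) t.
Proof.
by rewrite subst_tm_comp; apply: subst_tm_ext => i _; rewrite /up /= subst_num.
Qed.

Lemma num_eval_subst e t s :
  |- fEq (subst_tm s (subst_tm (num \o e) t)) (num (eval e t)).
Proof.
rewrite subst_tm_comp (@subst_tm_ext _ (num \o e)); first exact: num_eval.
by move=> i _; rewrite /= subst_num.
Qed.

Lemma inst_closed e A n :
  inst (subst_fm (up (num \o e)) A) (num n) = closed (scons n e) A.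
Proof. by rewrite inst_up; apply: subst_fm_ext => -[]. Qed.

(** * Sigma_1-completeness *)

(** Truth and provability are decided together: implications call for refutations of false formulas,
    and the disjunction spares the metatheory excluded middle. *)
Definition decided (P : Prop) (A : fm) : Prop := P /\ |- A \/ ~ P /\ |- fNot A.

Lemma decided_iff P Q A : (P <-> Q) -> decided P A -> decided Q A.
Proof. by rewrite /decided => E [[? ?]|[? ?]]; [left|right]; rewrite -E. Qed.

Lemma forall_lt_or P Q k : (forall n : nat, P n \/ Q n) ->
  (forall n, n < k -> P n) \/ (exists2 n, n < k & Q n).
Proof.
move=> PQ; elim: k => [|k [IH|[n Hn Qn]]]; first by left.
- case: (PQ k) => [Pk|Qk]; last by right; exists k.
  by left=> n; rewrite ltnS leq_eqVlt => /predU1P[->|/IH].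
- by right; exists n; first exact: ltnW.
Qed.

(** A search below k either finds every instance derivable, and the guard merges the derivations, or
    finds a refuted instance, which refutes the universal formula. *)
Lemma decided_all G A P k : guards G k ->
  (forall n, decided (P n) (inst A (num n))) ->
  decided (forall n, n < k -> P n) (fAll (fImp G A)).
Proof.
move=> [HG HA] D; case: (@forall_lt_or _ _ k D) => [H|[n Hn [NP NA]]]; [left|right].
  by split=> [n /H[]|] //; apply/derives_gen/HA => n /H[].
split=> [H|]; first exact/NP/H.
apply: imp_trans NA; apply: imp_trans (derives_logic (ax_allE _ (num n))) _.
exact: imp_mp (imp_refl _) (HG _ Hn).
Qed.

Lemma decided_ex G A P k : guards G k ->
  (forall n, decided (P n) (inst A (num n))) ->
  decided (exists2 n, n < k & P n) (fEx (fAnd G A)).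
Proof.
(* The disjuncts are swapped so that the search looks for a true instance. *)
move=> [HG HA] D; have D' n : ~ P n /\ |- fNot (inst A (num n)) \/ P n /\ |- inst A (num n).
  by case: (D n); [right|left].
case: (@forall_lt_or _ _ k D') => [H|[n Hn [Pn An]]]; [right|left].
  split=> [[n /H[]]|] //; apply: ex_elim; apply: and_elim; apply: HA => n Hn.
  exact: (H n Hn).2.
split; [by exists n|apply: (@ex_intro _ (num n))].
exact: and_intro (HG _ Hn) An.
Qed.

Lemma decided_delta0 A : delta0 A -> forall e, decided (sat e A) (closed e A).
Proof.
elim=> {A} [s t|s t||A B _ IA _ IB|A B _ IA _ IB|A B _ IA _ IB
  |t A _ IA|t A _ IA|t A _ IA|t A _ IA] e /=.
- have [E|/eqP E] := eqVneq (eval e s) (eval e t); [left|right]; split=> //.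
    by apply: eq_trans (num_eval e s) _; rewrite E; apply/eq_sym/num_eval.
  exact: imp_trans (eq_congr_eq (num_eval e s) (num_eval e t)) (eq_num E).
- have [E|E] := leqP (eval e s) (eval e t); [left|right]; split=> //.
  + apply: derives_mp (le_num E).
    by apply: eq_congr_le; apply/eq_sym/num_eval.
  + exact: imp_trans (eq_congr_le (num_eval e s) (num_eval e t)) (not_le_num E).
- by right; split=> //; apply: imp_refl.
- case: (IA e) => -[a ha]; first case: (IB e) => -[b hb].
  + by left; split=> //; apply: and_intro.
  + right; split=> [[]|] //; exact: imp_trans (derives_logic (ax_andEr _ _)) hb.
  + right; split=> [[]|] //; exact: imp_trans (derives_logic (ax_andEl _ _)) ha.
- case: (IA e) => -[a ha]; last case: (IB e) => -[b hb].
  + left; split; [by left|exact: derives_mp (derives_logic (ax_orIl _ _)) ha].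
  + left; split; [by right|exact: derives_mp (derives_logic (ax_orIr _ _)) hb].
  + right; split=> [[]|] //.
    exact: derives_mp (derives_mp (derives_logic (ax_orE _ _ _)) ha) hb.
- case: (IB e) => -[b hb]; last case: (IA e) => -[a ha].
  + by left; split=> //; apply: weaken.
  + right; split=> [/(_ a)|] //; apply: imp_trans hb.
    exact: imp_mp (imp_refl _) ha.
  + left; split=> // ; exact: imp_trans ha (derives_logic (ax_botE _)).
(* Shared by the four bounded quantifiers: the bound ignores the quantified variable, and its closed
   form provably equals a numeral, which supplies the guards. *)
all: have lift_eval n : eval (scons n e) (lift_tm t) = eval e t by rewrite eval_subst.
all: have D n : decided (sat (scons n e) A) (inst (subst_fm (up (num \o e)) A) (num n))
  by rewrite inst_closed.
all: have Glt := guards_lt (num_eval_subst e t).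
all: have Gle := guards_le (num_eval_subst e t).
all: rewrite up_num_lift.
- by apply: decided_iff (decided_all Glt D); split=> H n; have := H n; rewrite lift_eval.
- apply: decided_iff (decided_ex Glt D); split=> [[n]|[n []]]; last rewrite lift_eval.
    by exists n; rewrite lift_eval.
  by exists n.
- by apply: decided_iff (decided_all Gle D); split=> H n; have := H n; rewrite lift_eval.
- apply: decided_iff (decided_ex Gle D); split=> [[n]|[n []]]; last rewrite lift_eval.
    by exists n; rewrite lift_eval.
  by exists n.
Qed.

Lemma sigma1_complete A : sigma1 A -> forall e, sat e A -> |- closed e A.
Proof.
elim=> {A} [A /decided_delta0 D e|A _ IH e /= [n /IH H]]; first by case: (D e) => -[].
by apply: (@ex_intro _ (num n)); rewrite inst_closed.
Qed.

(** * Correctness of the Goedel numbering and of rho *)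

(** With s = a + b, the value s^2 + a lies between s^2 and (s + 1)^2 - 1, so it determines s, then
    a, then b. *)
Lemma npair_inj a b c d : npair a b = npair c d -> a = c /\ b = d.
Proof.
have lt x y u v : u <= x -> x < y -> x * x + u < y * y + v.
  move=> Hu Hxy; apply: leq_trans (leq_addr _ _); apply: leq_trans (leq_mul Hxy Hxy).
  by rewrite mulSn mulnS addSn ltnS addnA [_ + u]addnC leq_add2r (leq_trans Hu) ?leq_addr.
rewrite /npair => E.
have E' : a + b = c + d.
  case: (ltngtP (a + b) (c + d)) => // H; [have := lt _ _ a c _ H|have := lt _ _ c a _ H].
    by rewrite E ltnn leq_addr => /(_ isT).
  by rewrite E ltnn leq_addr => /(_ isT).
by move: E; rewrite E' => /addnI Eac; split=> //; move: E'; rewrite Eac => /addnI.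
Qed.

Notation code_tm' := (code_tm_with id npair (fun _ i => npair 1 i)).
Notation code_fm' := (code_fm_with id npair (fun _ i => npair 1 i)).

(** Constructors carry distinct tags, and the variable clause ignores the depth, so the depths may
    differ. *)
Lemma code_tm_inj d d' s t : code_tm' d s = code_tm' d' t -> s = t.
Proof.
elim: s t => [i||s IH|s IHs u IHu|s IHs u IHu] [j||t|t v|t v] /npair_inj[] //.
- by move=> _ ->.
- by move=> _ /IH->.
all: by move=> _ /npair_inj[/IHs-> /IHu->].
Qed.

Lemma code_fm_inj d d' A B : code_fm' d A = code_fm' d' B -> A = B.
Proof.
elim: A d d' B => [s t|s t||A IA B IB|A IA B IB|A IA B IB|A IA|A IA|A IA] d d'
  [s' t'|s' t'||A' B'|A' B'|A' B'|A'|A'|A'] /npair_inj[] //.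
1-2: by move=> _ /npair_inj[/code_tm_inj-> /code_tm_inj->].
1-3: by move=> _ /npair_inj[/IA-> /IB->].
all: by move=> _ /IA->.
Qed.

Lemma code_tm_depth d d' t : code_tm' d t = code_tm' d' t.
Proof. by elim: t => //= [t ->|t -> u ->|t -> u ->]. Qed.

(** Closed form of [num \o f] pushed below d quantifiers. *)
Definition num_below (d : nat) (f : nat -> nat) (i : nat) : tm :=
  if i < d then tVar i else num (f (i - d)).

Notation dotted_var :=
  (fun d i => if i < d then tpair (num 1) (num i) else tVar (i - d)).

Lemma eval_dotted_tm e f d t :
  (forall i, d + i < fvb_tm t -> e i = code_tm (num (f i))) ->
  eval e (code_tm_with num tpair dotted_var d t) =
  code_tm' d (subst_tm (num_below d f) t).
Proof.
elim: t => [i||t IH|t IHt u IHu|t IHt u IHu] /= E.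
- rewrite /num_below; case: ltnP => Hi; first by rewrite /= eval_num.
  by rewrite /= E ?subnKC //; apply: code_tm_depth.
- by [].
- by rewrite IH.
all: rewrite IHt ?IHu // => i Hi; apply: E.
all: by rewrite leq_max Hi ?orbT.
Qed.

Lemma eval_dotted_fm e f d A :
  (forall i, d + i < fvb A -> e i = code_tm (num (f i))) ->
  eval e (code_fm_with num tpair dotted_var d A) =
  code_fm' d (subst_fm (num_below d f) A).
Proof.
have upE n i : up (num_below n f) i = num_below n.+1 f i.
  by case: i => [|i] //; rewrite /up /num_below /= ltnS; case: ifP => //; rewrite subst_num.
elim: A d => [t u|t u||A IA B IB|A IA B IB|A IA B IB|A IA|A IA|A IA] d /= E.
1-2: rewrite !(@eval_dotted_tm _ f) // => i Hi; apply: E.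
1-4: by rewrite leq_max Hi ?orbT.
- by [].
1-3: rewrite IA ?IB // => i Hi; apply: E.
1-6: by rewrite leq_max Hi ?orbT.
1-2: rewrite IA ?(subst_fm_ext _ (upE d)) // => i Hi; apply: E.
(* One more quantifier raises the depth by one and lowers [fvb] by one. *)
1-2: by case: (fvb A) Hi.
by rewrite IA.
Qed.

(* The hypothesis is the reduced form of [sat e (fBeta a b i r)]. *)
Lemma beta_mod (a b i r : nat) :
  r < (i.+1 * b).+1 /\ (exists q, q <= a /\ a = q * (i.+1 * b).+1 + r) ->
  r = a %% (i.+1 * b).+1.
Proof. by case=> Hr [q [_ ->]]; rewrite modnMDl modn_small. Qed.

(** Beta values are remainders, hence unique, so by induction the n-th entry of the coded sequence
    is the code of [num n]. *)
Lemma sat_num_graph e : sat e fNumGraph -> e 1 = code_tm (num (e 0)).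
Proof.
case=> a [b [/beta_mod /= H0 [/beta_mod /= Hx Hstep]]].
rewrite Hx; set x := e 0 in Hx Hstep *.
(* The induction keeps [n <= x], as the step clause speaks only of places below [x]. *)
have: x <= x by []; move: {-2}x => n; elim: n => [|n IH] Hn; first by rewrite -H0.
have [|u [_ [/beta_mod /= Hu /beta_mod /= HSu]]] := Hstep n; first by [].
by rewrite -HSu Hu IH // ltnW.
Qed.

(** * Reading off the meaning of [fPr_dotted] *)

Lemma sat_iter_ex k F e : sat e (iter k fEx F) ->
  exists g, sat (fun i => if i < k then g i else e (i - k)) F.
Proof.
elim: k F => [|k IH] F; first move=> H.
  by exists e; apply: sat_eq_env H => i _; rewrite subn0.
rewrite iterSr => /IH [g [n H]]; exists (scons n g).
by apply: sat_eq_env H => -[].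
Qed.

Lemma sat_foldr_and (F : nat -> fm) G r e :
  sat e (foldr (fun i => fAnd (F i)) G r) ->
  (forall i, i \in r -> sat e (F i)) /\ sat e G.
Proof.
elim: r => [|j r IH] //= [Hj /IH[Hr HG]]; split=> // i.
by rewrite inE => /predU1P[->|/Hr].
Qed.

(** The [fNumGraph] conjuncts force the quantified variables to be codes of numerals, so the dotted
    term evaluates to the code of the closed formula. *)
Lemma sat_Pr_dotted Pr A e : sat e (fPr_dotted Pr A) -> fvb Pr <= 1 ->
  sat (scons (code (closed e A)) e) Pr.
Proof.
move=> /sat_iter_ex[g] /sat_foldr_and[Hg].
set e' := (fun i => _) in Hg *.
have He' i : i < fvb A -> e' i = code_tm (num (e i)).
  move=> Hi; have := Hg i; rewrite mem_iota Hi => /(_ isT).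
  rewrite sat_subst => /sat_num_graph /=.
  (* Below the k quantifiers, index k + i still denotes [e i]. *)
  by rewrite {2}/e' ltnNge leq_addr addKn.
rewrite /inst sat_subst => H HPr; apply: sat_eq_env H => i Hi.
have {Hi}-> : i = 0 by case: i Hi => // i Hi; have := leq_trans Hi HPr.
rewrite /= (@eval_dotted_fm _ e) // /code; congr code_fm_with.
by apply: subst_fm_ext => j; rewrite /num_below subn0.
Qed.

(** Unlike [decided_delta0], only truth is transferred: a box whose translation is false need not be
    refuted by [T]. *)
Lemma sigma1box_complete Pr A : provability_predicate T Pr -> sigma1box A ->
  forall e, sat e (rho Pr A) -> |- closed e A.
Proof.
move=> [_ HPr1 HPr].
elim=> {A} [A HA|A|A B _ IA _ IB|A B _ IA _ IB|A _ IA|t A _ IA] e.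
- by rewrite rho_id; [apply: sigma1_complete|apply: sigma1_arithmetical].
- move=> /sat_Pr_dotted/(_ HPr1) H.
  have [|B HB /code_fm_inj <- //] := (HPr (code (closed e (fBox A)))).1 _.
  (* Any environment will do, since [Pr] has at most the free variable 0, which holds the code. *)
  move=> e'; rewrite /inst sat_subst; apply: sat_eq_env H => i Hi.
  have {Hi}-> : i = 0 by case: i Hi => // i Hi; have := leq_trans Hi HPr1.
  by rewrite /= eval_num.
- by case=> /IA HA /IB; apply: and_intro.
- case=> [/IA|/IB].
    exact/derives_mp/derives_logic/ax_orIl.
  exact/derives_mp/derives_logic/ax_orIr.
- by case=> n /IA HA; apply: (@ex_intro _ (num n)); rewrite inst_closed.
- move=> H; rewrite /= up_num_lift; apply: derives_gen.
  (* The guard reduces the open implication to the finitely many instances below the value of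
     [t]. *)
  apply: (guards_lt (num_eval_subst e t)).2 => n Hn; rewrite inst_closed; apply: IA.
  by apply: H; rewrite /= eval_subst.
Qed.

End Derivations.

Theorem theorem6p16 (T : fm -> Prop) (hre : re_theory T) (hPA : extends_PAbox T)
    (Pr : fm) (hPr : provability_predicate T Pr)
    (phi : fm) (hphi : sigma1box phi) (hsent : sentence phi) :
  true_in_N (rho Pr phi) -> derives T phi.
Proof.
(* The environment [id] is arbitrary: closing a sentence by numerals leaves it unchanged. *)
move=> H; have := sigma1box_complete hPA hPr hphi (H id).
by rewrite (@subst_fm_ext_fvb _ tVar) ?subst_fm_var // hsent.
Qed.
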